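(* Let $\mathcal{S}$ be a unipotent numerical monoid in $G$. Then each of $Rel_R(\mathcal{S})$, $Rel_L(\mathcal{S})$ and $Rel_T(\mathcal{S})$ is closed under finite intersections and finite unions (of subsets of $G(\mathbb{N})$).
   Context: Setting: $n$ is a positive integer, $\mathbf{U}(n,\mathbb{C})$ is the group of upper triangular unipotent $n\times n$ complex matrices, and $G$ is a (Zariski) closed subgroup of it. $G_{\mathbb{Z}}$ is the group of matrices in $G$ with integer entries, and $G(\mathbb{N})$ is the monoid of matrices in $G_{\mathbb{Z}}$ all of whose entries lie in $\mathbb{N}=\{0,1,2,\dots\}$. Standing assumptions: the monoid $G(\mathbb{N})$ is finitely generated and $G_{\mathbb{Z}}$ is its group completion. A unipotent numerical monoid in $G$ is a finitely generated submonoid $\mathcal{S}\subseteq G(\mathbb{N})$ (containing the identity matrix) such that $G(\mathbb{N})\setminus\mathcal{S}$ is finite. For subsets of $G(\mathbb{N})$, $\mathcal{I}\mathcal{J}:=\{AB\mid A\in\mathcal{I},B\in\mathcal{J}\}$. A relative right (resp. left) ideal of $\mathcal{S}$ is a subset $\mathcal{I}\subseteq G(\mathbb{N})$ with $\mathcal{I}\mathcal{S}\subseteq\mathcal{I}$ (resp. $\mathcal{S}\mathcal{I}\subseteq\mathcal{I}$); a relative ideal is a subset that is both. $Rel_R(\mathcal{S})$, $Rel_L(\mathcal{S})$, $Rel_T(\mathcal{S})$ denote the semigroups (under the product of subsets) of all relative right ideals, relative left ideals, and relative ideals of $\mathcal{S}$, respectively. *)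

(* Defs.v *)
From mathcomp Require Import all_boot all_order all_algebra.
From mathcomp Require Import complex.
From mathcomp Require Import boolp classical_sets cardinality reals.
(* Not imported: its notations clash with those of mathcomp-analysis. *)
From mathcomp Require mpoly.

Set Implicit Arguments.
Unset Strict Implicit.
Unset Printing Implicit Defensive.

Import GRing.Theory.
Local Open Scope classical_set_scope.
Local Open Scope ring_scope.

Section Matrices.
Variables (K : fieldType) (n : nat).
Implicit Types (A B : 'M[K]_n) (G M S I J : set 'M[K]_n).

Definition unipotent_upper : set 'M[K]_n :=
  [set A | (forall i : 'I_n, A i i = 1) /\
           (forall i j : 'I_n, (j < i)%N -> A i j = 0)].

(* The n * n variables are the matrix entries, listed row by row. *)
Definition zero_locus (P : set (mpoly.mpoly (n * n) K)) : set 'M[K]_n :=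
  [set A | forall p, P p -> mpoly.meval (fun k => mxvec A 0 k) p = 0].

Record closed_unipotent_subgroup G : Prop := ClosedUnipotentSubgroup {
  cus_closed : exists P : set (mpoly.mpoly (n * n) K),
    G = unipotent_upper `&` zero_locus P;
  cus_one : G 1%:M;
  cus_mul : forall A B, G A -> G B -> G (A *m B);
  cus_inv : forall A, G A -> G (invmx A) }.

Definition integer_points G : set 'M[K]_n :=
  [set A | G A /\ forall i j, exists z : int, A i j = z%:~R].

Definition natural_points G : set 'M[K]_n :=
  [set A | integer_points G A /\ forall i j, exists k : nat, A i j = k%:R].

Definition submonoid M : Prop :=
  M 1%:M /\ forall A B, M A -> M B -> M (A *m B).

Definition finitely_generated M : Prop :=
  exists2 F : set 'M[K]_n, finite_set F & M = smallest submonoid F.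

Definition monoid_hom_on M (H : groupType) (f : 'M[K]_n -> H) : Prop :=
  f 1%:M = 1%g /\ forall A B, M A -> M B -> f (A *m B) = (f A * f B)%g.

(* The inclusion of the monoid M in the group Q is universal among the monoid
   morphisms from M to groups. A map defined on M or on Q is represented by a
   function on all matrices, of which only the values on M or Q matter; a
   monoid morphism between groups is a group morphism. *)
Definition group_completion M Q : Prop :=
  M `<=` Q /\
  forall (H : groupType) (f : 'M[K]_n -> H), monoid_hom_on M f ->
    (exists2 g : 'M[K]_n -> H, monoid_hom_on Q g & {in M, g =1 f}) /\
    (forall g h : 'M[K]_n -> H, monoid_hom_on Q g -> monoid_hom_on Q h ->
       {in M, g =1 f} -> {in M, h =1 f} -> {in Q, g =1 h}).

Record unipotent_numerical_monoid G S : Prop := UnipotentNumericalMonoid {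
  unm_sub : S `<=` natural_points G;
  unm_submonoid : submonoid S;
  unm_fg : finitely_generated S;
  unm_cofinite : finite_set (natural_points G `\` S) }.

Definition mulset I J : set 'M[K]_n := [set A *m B | A in I & B in J].

(* The empty set is allowed as a relative ideal. *)
Definition Rel_R G S : set (set 'M[K]_n) :=
  [set I | I `<=` natural_points G /\ mulset I S `<=` I].

Definition Rel_L G S : set (set 'M[K]_n) :=
  [set I | I `<=` natural_points G /\ mulset S I `<=` I].

Definition Rel_T G S : set (set 'M[K]_n) := Rel_R G S `&` Rel_L G S.

Lemma mulsetA I J M : mulset I (mulset J M) = mulset (mulset I J) M.
Proof.
apply/seteqP; split=> [_ [A IA [_ [B JB [D MD <-]] <-]]|].
  by rewrite mulmxA; exists (A *m B); [exists A => //; exists B | exists D].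
move=> _ [_ [A IA [B JB <-]] [D MD <-]].
by rewrite -mulmxA; exists A => //; exists (B *m D) => //; exists B => //; exists D.
Qed.

Lemma mulsetS I I' J J' : I `<=` I' -> J `<=` J' -> mulset I J `<=` mulset I' J'.
Proof.
by move=> sI sJ _ [A IA [B JB <-]]; exists A; [exact: sI | exists B => //; exact: sJ].
Qed.

Lemma mulset_natural_points G I J : closed_unipotent_subgroup G ->
  I `<=` natural_points G -> J `<=` natural_points G ->
  mulset I J `<=` natural_points G.
Proof.
move=> hG sI sJ _ [A /sI [[GA _] nA] [B /sJ [[GB _] nB] <-]].
have nAB i j : exists k : nat, (A *m B) i j = k%:R.
  rewrite mxE; elim/big_ind: _ => [|x y [a ->] [b ->]|l _]; first by exists 0%N.
    by exists (a + b)%N; rewrite natrD.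
  have [[a ->] [b ->]] := (nA i l, nB l j).
  by exists (a * b)%N; rewrite natrM.
split=> //; split; first exact: (cus_mul hG).
by move=> i j; have [k ->] := nAB i j; exists k%:Z.
Qed.

Lemma Rel_R_mul G S I J : closed_unipotent_subgroup G ->
  Rel_R G S I -> Rel_R G S J -> Rel_R G S (mulset I J).
Proof.
move=> hG [sI _] [sJ JS]; split; first exact: mulset_natural_points.
by rewrite -mulsetA; exact: mulsetS.
Qed.

Lemma Rel_L_mul G S I J : closed_unipotent_subgroup G ->
  Rel_L G S I -> Rel_L G S J -> Rel_L G S (mulset I J).
Proof.
move=> hG [sI SI] [sJ _]; split; first exact: mulset_natural_points.
by rewrite mulsetA; exact: mulsetS.
Qed.

Lemma Rel_T_mul G S I J : closed_unipotent_subgroup G ->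
  Rel_T G S I -> Rel_T G S J -> Rel_T G S (mulset I J).
Proof.
by move=> hG [RI LI] [RJ LJ]; split; [exact: Rel_R_mul | exact: Rel_L_mul].
Qed.

End Matrices.

(* Intersections are taken in the ambient set X, so that the intersection of
   the empty family is X. *)
Definition closed_finite_intersections (T : Type) (X : set T)
    (C : set (set T)) : Prop :=
  forall F : set (set T), finite_set F -> F `<=` C -> C (X `&` \bigcap_(I in F) I).

Definition closed_finite_unions (T : Type) (C : set (set T)) : Prop :=
  forall F : set (set T), finite_set F -> F `<=` C -> C (\bigcup_(I in F) I).

(* Main.v *)
Require Import Defs.
From mathcomp Require Import all_boot all_order all_algebra.
From mathcomp Require Import complex.
From mathcomp Require Import boolp classical_sets cardinality reals.

(** Relative ideals are the subsets of [natural_points G] stable under a family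
    of maps, namely the multiplications by the elements of [S]; stability under
    a map passes to arbitrary unions and intersections. The empty intersection
    is [natural_points G] itself, which is stable because it is a monoid
    containing [S]. *)

Section StableSubsets.
Local Open Scope classical_set_scope.

(** An arbitrary set [Phi] of self-maps lets right and left multiplications be treated by the same
    lemmas. *)
Definition stable_subsets {T : Type} (X : set T) (Phi : set (T -> T)) :
    set (set T) :=
  [set I | I `<=` X /\ forall f, Phi f -> f @` I `<=` I].

Lemma stable_subsets_bigcap {T : Type} (X : set T) (Phi : set (T -> T)) :
  stable_subsets X Phi X ->
  closed_finite_intersections X (stable_subsets X Phi).
Proof.
move=> [_ stX] F _ FC; split=> [x []//|f Pf _ [x [Xx Fx] <-]].
(* The image must stay in [X] as well as in each member of [F]; the former is the stability of
   [X]. *)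
split=> [|I FI]; first by apply: (stX f Pf); exists x.
by apply: ((FC I FI).2 f Pf); exists x => //; exact: Fx.
Qed.

(** A map of [Phi] sends a point of the union into the very member that contains it. The empty
    family gives the empty set, which is vacuously stable. *)
Lemma stable_subsets_bigcup {T : Type} (X : set T) (Phi : set (T -> T)) :
  closed_finite_unions (stable_subsets X Phi).
Proof.
move=> F _ FC; split=> [x [I FI Ix]|f Pf _ [x [I FI Ix] <-]].
  exact: (FC I FI).1.
by exists I => //; apply: ((FC I FI).2 f Pf); exists x.
Qed.

(** Reduces the two-sided case to the one-sided ones: a family in [C] and [D] at once has its
    intersection in each. *)
Lemma closed_finite_intersectionsI {T : Type} (X : set T)
    (C D : set (set T)) :
  closed_finite_intersections X C -> closed_finite_intersections X D ->
  closed_finite_intersections X (C `&` D).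
Proof.
move=> hC hD F finF FCD; split; [apply: hC | apply: hD] => // I /FCD [] //.
Qed.

Lemma closed_finite_unionsI {T : Type} (C D : set (set T)) :
  closed_finite_unions C -> closed_finite_unions D ->
  closed_finite_unions (C `&` D).
Proof.
move=> hC hD F finF FCD; split; [apply: hC | apply: hD] => // I /FCD [] //.
Qed.

(** [mulset I S] is the union of the images of [I] under right multiplication by the elements of
    [S]. *)
Lemma Rel_RE {K : fieldType} {n : nat} (G S : set 'M[K]_n) :
  Rel_R G S =
  stable_subsets (natural_points G) [set mulmx^~ B | B in S].
Proof.
apply/seteqP; split=> I [sI st]; split=> //.
  by move=> _ [B SB <-] _ [A IA <-]; apply: st; exists A => //; exists B.
move=> _ [A IA [B SB <-]].
by apply: (st (mulmx^~ B)); [exists B | exists A].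
Qed.

Lemma Rel_LE {K : fieldType} {n : nat} (G S : set 'M[K]_n) :
  Rel_L G S =
  stable_subsets (natural_points G) [set mulmx B | B in S].
Proof.
apply/seteqP; split=> I [sI st]; split=> //.
  by move=> _ [B SB <-] _ [A IA <-]; apply: st; exists B => //; exists A.
move=> _ [B SB [A IA <-]].
by apply: (st (mulmx B)); [exists B | exists A].
Qed.

Lemma Rel_R_natural_points {K : fieldType} {n : nat} (G S : set 'M[K]_n) :
  closed_unipotent_subgroup G -> S `<=` natural_points G ->
  Rel_R G S (natural_points G).
Proof. by move=> hG sS; split=> //; exact: mulset_natural_points. Qed.

Lemma Rel_L_natural_points {K : fieldType} {n : nat} (G S : set 'M[K]_n) :
  closed_unipotent_subgroup G -> S `<=` natural_points G ->
  Rel_L G S (natural_points G).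
Proof. by move=> hG sS; split=> //; exact: mulset_natural_points. Qed.

End StableSubsets.

Theorem theorem4p9 (R : realType) (n : nat) (n_gt0 : (0 < n)%N)
    (G : set 'M[R[i]]_n) (hG : closed_unipotent_subgroup G)
    (hfg : finitely_generated (natural_points G))
    (hgc : group_completion (natural_points G) (integer_points G))
    (S : set 'M[R[i]]_n) (hS : unipotent_numerical_monoid G S) :
  [/\ closed_finite_intersections (natural_points G) (Rel_R G S) /\
      closed_finite_unions (Rel_R G S),
      closed_finite_intersections (natural_points G) (Rel_L G S) /\
      closed_finite_unions (Rel_L G S)
    & closed_finite_intersections (natural_points G) (Rel_T G S) /\
      closed_finite_unions (Rel_T G S)].
Proof.
have sS := unm_sub hS.
have capR : closed_finite_intersections (natural_points G) (Rel_R G S).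
  have := Rel_R_natural_points _ _ hG sS.
  (* The rewriting acts on both the premise, stability of the ambient monoid, and the conclusion. *)
  by rewrite Rel_RE; exact: stable_subsets_bigcap.
have capL : closed_finite_intersections (natural_points G) (Rel_L G S).
  have := Rel_L_natural_points _ _ hG sS.
  by rewrite Rel_LE; exact: stable_subsets_bigcap.
have cupR : closed_finite_unions (Rel_R G S).
  by rewrite Rel_RE; exact: stable_subsets_bigcup.
have cupL : closed_finite_unions (Rel_L G S).
  by rewrite Rel_LE; exact: stable_subsets_bigcup.
(* Only the two claims on [Rel_T] remain, and [Rel_T] is by definition the intersection of [Rel_R]
   and [Rel_L]. *)
split; split=> //; first exact: closed_finite_intersectionsI.
exact: closed_finite_unionsI.
Qed.
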